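(* Let $(\lambda_1,\lambda_2)$ and $(\mu_1,\mu_2)$ be two distinct partitions of $n$ with exactly two (positive) parts each. Then there exist commuting nilpotent $n\times n$ matrices $B,A$ over $\mathbb{F}$ with $\mathrm{sh}(B)=(\lambda_1,\lambda_2)$ and $\mathrm{sh}(A)=(\mu_1,\mu_2)$ if and only if $n$ is even and one of the two partitions equals $(\frac n2,\frac n2)$ and the other equals $(\frac n2+1,\frac n2-1)$.
   Context: $\mathbb{F}$ is an algebraically closed field of characteristic $0$. For a nilpotent matrix $A$, $\mathrm{sh}(A)$ is the partition of $n$ given by the sizes of the Jordan blocks of its Jordan canonical form. *)

(* Defs.v *)
From HB Require Import structures.
From mathcomp Require Import all_boot all_order all_algebra.
Set Implicit Arguments. Unset Strict Implicit. Unset Printing Implicit Defensive.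
Import GRing.Theory.
Local Open Scope ring_scope.

Definition is_partition (s : seq nat) (n : nat) : bool :=
  [&& sorted geq s, all (fun x => 0 < x)%N s & sumn s == n].

(* Starting indices (0-based) of the blocks 2,3,...: the partial sums of s. *)
Definition block_starts (s : seq nat) : seq nat :=
  [seq sumn (take k s) | k <- iota 1 (size s)].

(* The nilpotent Jordan matrix diag(J_{s_1}, ..., J_{s_k}), where J_m is the
   m x m nilpotent Jordan block (ones on the superdiagonal). *)
Definition jordan_nil_mx (F : nzRingType) (n : nat) (s : seq nat) : 'M[F]_n :=
  \matrix_(i < n, j < n)
     (((nat_of_ord j == (nat_of_ord i).+1) && (nat_of_ord j \notin block_starts s))%:R).

Definition nilpotent_mx (F : nzRingType) (n : nat) (A : 'M[F]_n) : Prop :=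
  exists k : nat, A ^+ k = 0.

Definition jordan_shape (F : fieldType) (n : nat) (A : 'M[F]_n) (s : seq nat) : Prop :=
  is_partition s n /\
  exists P : 'M[F]_n, P \in unitmx /\ A = invmx P *m jordan_nil_mx F n s *m P.

(* Main.v *)
(** Matrices act on row vectors from the right, so the row space of [A] is the
image of [A].  Let [A], [B] be commuting nilpotents with two blocks each and
largest parts [a1 < b1].  Equal images would give [A] and [B] powers of equal
ranks, so the images differ and [N = im A + im B] has codimension at most 1.
Nakayama's lemma for nilpotents then yields [N A = N B], hence
[N A^i = N B^i] for all [i], so the ranks of [A^i] and [B^i] differ by at most
1.  At [i = a1] this gives [b1 = a1 + 1].  If moreover [a2 < a1], then at
[i = a1 - 1] the line [X = im A^i] satisfies [X = X B], which is absurd.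
Conversely, on two copies of [F[t]/(t^k)], multiplication by [t] has shape
[(k, k)] and commutes with [t + E], where [E] maps the first copy to the
second and kills the second; [(t + E)^k] is [k t^(k-1) E], nonzero in
characteristic 0, and [t + E] has shape [(k+1, k-1)]. *)

Require Import Defs.
From HB Require Import structures.
From mathcomp Require Import all_boot all_order all_algebra.
From mathcomp Require Import zify.
Import GRing.Theory.
Local Open Scope ring_scope.

(** * Powers of nilpotent Jordan matrices and their ranks *)

(** On coefficient rows of F[t]/(t^m) this is multiplication by t^k. *)
Definition shift_mx (F : nzRingType) (m k : nat) : 'M[F]_m :=
  \matrix_(i < m, j < m) ((j == i + k :> nat)%N)%:R.

(** The monomial t^d; [d] is a plain natural number so that t^d = 0 for [d >= m] needs no side
    condition. *)
Definition nat_row (F : nzRingType) (m d : nat) : 'rV[F]_m :=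
  \row_(j < m) (j == d :> nat)%:R.

Lemma nat_row_shift (F : nzRingType) (m d k : nat) :
  nat_row F m d *m shift_mx F m k = nat_row F m (d + k).
Proof.
apply/rowP => j; rewrite !mxE.
have [dm|dm] := ltnP d m.
  rewrite (bigD1 (Ordinal dm)) //= !mxE eqxx mul1r big1 ?addr0 // => i ne.
  rewrite !mxE; case: eqP => [e|]; last by rewrite mul0r.
  by case/eqP: ne; apply: val_inj.
rewrite big1 => [|i _]; first by case: eqP => // e; have := ltn_ord j; lia.
by rewrite !mxE; case: eqP => [e|]; [have := ltn_ord i; lia | rewrite mul0r].
Qed.

Lemma nat_row_out (F : nzRingType) (m d : nat) : (m <= d)%N -> nat_row F m d = 0.
Proof.
by move=> md; apply/rowP => j; rewrite !mxE; case: eqP => // e; have := ltn_ord j; lia.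
Qed.

Lemma row_shift (F : nzRingType) (m k : nat) (i : 'I_m) :
  row i (shift_mx F m k) = nat_row F m (i + k).
Proof. by apply/rowP => j; rewrite !mxE. Qed.

Lemma shift_mxM (F : nzRingType) (m k l : nat) :
  shift_mx F m k *m shift_mx F m l = shift_mx F m (k + l).
Proof. by apply/row_matrixP => i; rewrite row_mul !row_shift nat_row_shift addnA. Qed.

Lemma shift_mx0 (F : nzRingType) (m : nat) : shift_mx F m 0 = 1%:M.
Proof. by apply/matrixP => i j; rewrite !mxE addn0 eq_sym. Qed.

Lemma shift_mxX (F : nzRingType) (m k : nat) : shift_mx F m 1 ^+ k = shift_mx F m k.
Proof.
elim: k => [|k IH]; first by rewrite shift_mx0.
by rewrite exprSr IH -mulmxE shift_mxM addn1.
Qed.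

(** Only the first [m - k] rows are nonzero, which bounds the rank above; they are distinct unit
    vectors, so the product with the transpose is [pid_mx (m - k)], which bounds it below. *)
Lemma rank_shift_mx (F : fieldType) (m k : nat) : \rank (shift_mx F m k) = (m - k)%N.
Proof.
have le_mk : (m - k <= m)%N by rewrite leq_subr.
apply/eqP; rewrite eqn_leq; apply/andP; split.
  have -> : shift_mx F m k = pid_mx (m - k) *m shift_mx F m k.
    apply/row_matrixP => i; rewrite row_mul row_shift.
    have -> : row i (pid_mx (m - k)) = (i < m - k)%:R *: nat_row F m i.
      by apply/rowP => j; rewrite !mxE -natrM mulnb andbC eq_sym.
    rewrite -scalemxAl nat_row_shift.
    case: ltnP => ik; rewrite ?scale1r // scale0r nat_row_out //; lia.
  by apply: leq_trans (mxrankM_maxl _ _) _; rewrite rank_pid_mx.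
have <- : \rank (shift_mx F m k *m (shift_mx F m k)^T) = (m - k)%N.
  rewrite -[RHS](@rank_pid_mx F m m) //; congr (\rank _).
  apply/matrixP => i j; rewrite !mxE.
  have [ik|ik] := ltnP (i + k) m.
    rewrite (bigD1 (Ordinal ik)) //= !mxE eqxx mul1r eqn_add2r big1 => [|c ne].
      by rewrite addr0 (_ : (i < m - k)%N) ?andbT //; lia.
    rewrite !mxE; case: eqP => [e|]; last by rewrite mul0r.
    by case/eqP: ne; apply: val_inj.
  rewrite big1 => [|c _]; first by rewrite (_ : (i < m - k)%N = false) ?andbF //; lia.
  by rewrite !mxE; case: eqP => [e|]; [have := ltn_ord c; lia | rewrite mul0r].
exact: mxrankM_maxl.
Qed.

Lemma jordan_nil_mx2E (F : nzRingType) (a b : nat) :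
  jordan_nil_mx F (a + b) [:: a; b]
    = block_mx (shift_mx F a 1) 0 0 (shift_mx F b 1).
Proof.
have boolr (c d : bool) : c = d -> c%:R = d%:R :> F by move->.
apply/matrixP => i j.
case: (split_ordP i) => i' ->; case: (split_ordP j) => j' ->;
  rewrite ?block_mxEul ?block_mxEur ?block_mxEdl ?block_mxEdr !mxE;
  rewrite /block_starts /= !addn0 !inE;
  have := ltn_ord i'; have := ltn_ord j' => Hj Hi;
  first [apply: boolr | apply: (boolr _ false)]; lia.
Qed.

Lemma block_diag_exp (F : nzRingType) (a b : nat) (A : 'M[F]_a) (B : 'M[F]_b) (k : nat) :
  (block_mx A 0 0 B) ^+ k = block_mx (A ^+ k) 0 0 (B ^+ k).
Proof.
elim: k => [|k IH]; first by rewrite !expr0 -scalar_mx_block.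
by rewrite !exprS IH -!mulmxE mulmx_block !mulmx0 !mul0mx !addr0 !add0r.
Qed.

(** Powers pass through conjugation and act blockwise. The truncated subtractions make a block of
    size at most [k] contribute 0. *)
Lemma jordan_shape_rank (F : fieldType) (n a b : nat) (A : 'M[F]_n) (k : nat) :
  jordan_shape A [:: a; b] -> \rank (A ^+ k) = ((a - k) + (b - k))%N.
Proof.
case=> /and3P[_ _ /eqP /= nE] [P [uP ->]].
rewrite addn0 in nE; subst n.
have -> : (invmx P *m jordan_nil_mx F (a + b) [:: a; b] *m P) ^+ k
          = invmx P *m jordan_nil_mx F (a + b) [:: a; b] ^+ k *m P.
  elim: k => [|k IH]; first by rewrite !expr0 mulmx1 mulVmx.
  by rewrite !exprSr IH -!mulmxE !mulmxA mulmxK.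
rewrite mxrankMfree ?row_free_unit // eqmxMfull ?row_full_unit ?unitmx_inv //.
by rewrite jordan_nil_mx2E block_diag_exp !shift_mxX rank_diag_block_mx !rank_shift_mx.
Qed.

Lemma jordan_shape_nilp (F : fieldType) (n a b : nat) (A : 'M[F]_n) (k : nat) :
  jordan_shape A [:: a; b] -> (a <= k)%N -> A ^+ k = 0.
Proof.
move=> sA ak; apply/eqP; rewrite -mxrank_eq0 (jordan_shape_rank _ _ _ _ _ _ sA).
by case: sA => /and3P[/= /andP[ba _] _ _] _; rewrite /geq /= in ba; lia.
Qed.

(** * Images of commuting nilpotents: the constraint on the shapes *)

(** Since [C] preserves [Y], substituting the last inclusion into itself gives X <= Y + X C^k for
    every exponent, and the second term eventually vanishes. *)
Lemma nilp_nakayama (F : fieldType) (n : nat) (X Y C : 'M[F]_n) (k : nat) :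
  C ^+ k = 0 -> (Y *m C <= Y)%MS -> (X <= Y + X *m C)%MS -> (X <= Y)%MS.
Proof.
move=> Ck YC XC.
suff: (X <= Y + X *m C ^+ k)%MS by rewrite Ck mulmx0 addsmx0.
elim: k {Ck} => [|k IH]; first by rewrite expr0 mulmx1 addsmxSr.
have YCk : (Y *m C ^+ k <= Y)%MS.
  elim: k {IH} => [|k IH]; first by rewrite expr0 mulmx1.
  by rewrite exprSr -mulmxE mulmxA (submx_trans (submxMr C IH)).
apply: (submx_trans IH); rewrite addsmx_sub addsmxSl /=.
apply: (submx_trans (submxMr _ XC)); rewrite addsmxMr.
by rewrite -mulmxA mulmxE -exprS; apply: addsmxS.
Qed.

(** One half of N A = N B for N = im A + im B; exchanging [A] and [B] gives the other half. As B A =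
    A B already lies in N B, only A A <= N B is at stake. *)
Lemma sum_images_mul_sub (F : fieldType) (n : nat) (A B : 'M[F]_n) (k : nat) :
  A *m B = B *m A -> A ^+ k = 0 -> B ^+ k = 0 ->
  \rank A = \rank B -> n = (\rank B).+2 -> ~~ (B <= A)%MS ->
  ((A + B)%MS *m A <= (A + B)%MS *m B)%MS.
Proof.
move=> AB Ak Bk rAB nE nBA.
have BA_A : (B *m A <= A)%MS by rewrite submxMl.
have AB_B : (A *m B <= B)%MS by rewrite submxMl.
have nAB : ~~ (A <= B)%MS.
  by apply: contra nBA => sAB; rewrite -(geq_leqif (mxrank_leqif_sup sAB)) rAB.
(* If N were everything, Nakayama modulo im B would make [B] surjective. *)
have rN : (\rank (A + B)%MS < n)%N.
  rewrite ltn_neqAle rank_leq_col andbT; apply/negP => fullN.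
  have : (1%:M <= B)%MS.
    apply: (nilp_nakayama _ _ _ _ A k) => //; first by rewrite -AB.
    by rewrite mul1mx addsmxC sub1mx.
  by rewrite sub1mx => /eqP; lia.
(* [A] acts nilpotently on the 2-dimensional cokernel of [B]. *)
have AAB : (A *m A <= B)%MS.
  have sub : (B + A *m A <= A + B)%MS.
    by rewrite addsmx_sub addsmxSr (submx_trans (submxMl A A)) ?addsmxSl.
  have [eN|ltN] := eqVneq (\rank (B + A *m A)%MS) (\rank (A + B)%MS).
    have sN : (A + B <= B + A *m A)%MS by rewrite -(geq_leqif (mxrank_leqif_sup sub)) eN.
    have {}sN := submx_trans (addsmxSl A B) sN.
    by case/negP: nAB; apply: (nilp_nakayama _ _ _ _ A k) sN; rewrite // -AB.
  have := mxrankS sub; move: ltN => /eqP ltN le.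
  have sB := addsmxSl B (A *m A).
  have sN : (B + A *m A <= B)%MS.
    by rewrite -(geq_leqif (mxrank_leqif_sup sB)); lia.
  exact: submx_trans (addsmxSr _ _) sN.
have AB_NB : (A *m B <= (A + B)%MS *m B)%MS by rewrite submxMr ?addsmxSl.
rewrite (addsmxMr A B A) addsmx_sub -AB AB_NB andbT.
have NB_B : ((A + B)%MS *m B <= B)%MS by rewrite submxMl.
(* N has codimension at most 1, so multiplying by [B] loses at most one dimension of im B. *)
have rNB : (\rank B <= (\rank ((A + B)%MS *m B)).+1)%N.
  have := mxrank_mul_min (A + B)%MS B.
  suff : (\rank A < \rank (A + B)%MS)%N by lia.
  have ltAN : (A < A + B)%MS by rewrite ltmxE addsmxSl addsmx_sub submx_refl nBA.
  exact: rank_ltmx.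
(* If A A is not inside N B, then N B + A A fills im B, whence B <= A + B B, and Nakayama modulo im
   A gives B <= A. *)
apply: contraR nBA => nAA.
apply: (nilp_nakayama _ _ _ _ B k) => //; first by rewrite AB.
have sB : ((A + B)%MS *m B + A *m A <= B)%MS by rewrite addsmx_sub NB_B.
have ltNB : ((A + B)%MS *m B < (A + B)%MS *m B + A *m A)%MS.
  by rewrite ltmxE addsmxSl addsmx_sub submx_refl.
have le : (B <= (A + B)%MS *m B + A *m A)%MS.
  by rewrite -(geq_leqif (mxrank_leqif_sup sB)); have := rank_ltmx ltNB; lia.
apply: (submx_trans le); rewrite addsmx_sub addsmxMr; apply/andP; split.
  by rewrite AB addsmxS.
by rewrite (submx_trans (submxMl A A)) ?addsmxSl.
Qed.

(** Inductively, N A^(i+1) = N B^i A = N A B^i = N B B^i. *)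
Lemma eqmx_mulX (F : fieldType) (m n : nat) (N : 'M[F]_(m, n)) (A B : 'M[F]_n) (i : nat) :
  A *m B = B *m A -> (N *m A :=: N *m B)%MS -> (N *m A ^+ i :=: N *m B ^+ i)%MS.
Proof.
move=> AB NAB; elim: i => [|i IH]; first by rewrite !expr0.
have ABi : A *m B ^+ i = B ^+ i *m A by apply: (@commrX 'M[F]_n A B i).
rewrite exprSr -mulmxE mulmxA; apply: (eqmx_trans (eqmxMr A IH)).
rewrite -mulmxA -ABi mulmxA exprS -mulmxE [X in (_ :=: X)%MS]mulmxA.
exact: eqmxMr.
Qed.

Lemma comm_two_blocks_shapes (F : fieldType) (n a1 a2 b1 b2 : nat) (A B : 'M[F]_n) :
  A *m B = B *m A -> jordan_shape A [:: a1; a2] -> jordan_shape B [:: b1; b2] ->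
  (a1 < b1)%N -> a1 = a2 /\ b1 = a1.+1.
Proof.
move=> AB sA sB ab.
have rA := jordan_shape_rank _ _ _ _ _ _ sA.
have rB := jordan_shape_rank _ _ _ _ _ _ sB.
have [a2a1 a2_gt0 nEa] : [/\ a2 <= a1, 0 < a2 & n = a1 + a2]%N.
  by case: sA => /and3P[/= /andP[le _] /and3P[_ ? _] /eqP e] _; split => //; lia.
have [b2b1 b2_gt0 nEb] : [/\ b2 <= b1, 0 < b2 & n = b1 + b2]%N.
  by case: sB => /and3P[/= /andP[le _] /and3P[_ ? _] /eqP e] _; split => //; lia.
have Ak := jordan_shape_nilp _ _ _ _ _ b1 sA (ltnW ab).
have Bk := jordan_shape_nilp _ _ _ _ _ b1 sB (leqnn _).
have r1A := rA 1%N; have r1B := rB 1%N; rewrite !expr1 in r1A r1B.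
have nBA : ~~ (B <= A)%MS.
  apply/negP => sBA; have eBA : (B :=: A)%MS.
    by apply/eqmxP; rewrite sBA -(geq_leqif (mxrank_leqif_sup sBA)); lia.
  (* With N the whole space, A^a1 and B^a1 would have equal ranks, but the first is 0 and the second
     is at least [b1 - a1]. *)
  have := eqmx_mulX _ _ _ 1%:M _ _ a1 (esym AB).
  by rewrite !mul1mx => /(_ eBA) e; have := rA a1; rewrite -e rB; lia.
have nAB : ~~ (A <= B)%MS.
  by apply: contra nBA => sAB; rewrite -(geq_leqif (mxrank_leqif_sup sAB)); lia.
pose N := (A + B)%MS.
have NAB : (N *m A :=: N *m B)%MS.
  apply/eqmxP/andP; split; first by apply: (sum_images_mul_sub _ _ _ _ b1) => //; lia.
  rewrite /N; apply: (submx_trans (submxMr _ (_ : _ <= B + A)%MS)).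
    by rewrite addsmxC.
  apply: (submx_trans (sum_images_mul_sub _ _ _ _ b1 _ _ _ _ _ _)) => //; try lia.
  by rewrite submxMr // addsmxC.
have rN : (n <= (\rank N).+1)%N.
  have ltBN : (B < N)%MS by rewrite ltmxE addsmxSr addsmx_sub submx_refl andbT nAB.
  by have := rank_ltmx ltBN; lia.
have rNX i : \rank (N *m A ^+ i) = \rank (N *m B ^+ i).
  by rewrite (eqmx_mulX _ _ _ _ _ _ i AB NAB).
(* N B^a1 has the rank of N A^a1 = 0, so B^a1 has rank at most 1. *)
have b1E : b1 = a1.+1.
  have := mxrank_mul_min N (B ^+ a1); rewrite -rNX rB.
  by rewrite (jordan_shape_nilp _ _ _ _ _ a1 sA) // mulmx0 mxrank0; lia.
split=> //; apply/eqP; apply: contraT => /eqP ne.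
pose X := A ^+ a1.-1.
have rX : \rank X = 1%N by rewrite rA; lia.
(* B^(a1-1) has rank at least 2, so N B^(a1-1), hence N X, is nonzero and fills the line [X]. Since
   A X = 0, this gives X <= B X = X B. *)
have XN : (X <= N *m X)%MS.
  have sNX : (N *m X <= X)%MS by rewrite submxMl.
  rewrite -(geq_leqif (mxrank_leqif_sup sNX)) rX rNX.
  by have := mxrank_mul_min N (B ^+ a1.-1); rewrite rB; lia.
have BX : B *m X = X *m B by apply: (@commrX 'M[F]_n B A a1.-1).
have AX : A *m X = 0.
  by rewrite mulmxE -exprS (jordan_shape_nilp _ _ _ _ _ _ sA) //; lia.
have : (X <= (0 : 'M_n))%MS.
  apply: (nilp_nakayama _ _ _ _ B b1) => //; first by rewrite mul0mx.
  by apply: (submx_trans XN); rewrite addsmxMr AX BX.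
by rewrite submx0 -mxrank_eq0 rX.
Qed.

(** * Jordan bases from chains, and the commuting pair *)

Definition chains_mx (F : nzRingType) (n : nat) (B : 'M[F]_n) (a : nat)
    (u w : 'rV[F]_n) : 'M[F]_n :=
  \matrix_(i < n) (if (i < a)%N then u *m B ^+ i else w *m B ^+ (i - a)).

Lemma row_jordan_nil_mx (F : nzRingType) (n : nat) (s : seq nat) (i : 'I_n) :
  row i (jordan_nil_mx F n s) =
    if (i.+1 \in block_starts s) then 0 else nat_row F n i.+1.
Proof.
apply/rowP => j; rewrite !mxE.
have [e|ne] := eqVneq (j : nat) i.+1.
  by rewrite e; case: ifP => _; rewrite !mxE ?e ?eqxx.
by case: ifP => _; rewrite !mxE // (negbTE ne).
Qed.

Lemma nat_row_delta (F : nzRingType) (m : nat) (d : 'I_m) : nat_row F m d = delta_mx 0 d.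
Proof. by apply/rowP => j; rewrite !mxE. Qed.

Lemma nat_row_mul (F : nzRingType) (m n : nat) (d : 'I_m) (P : 'M[F]_(m, n)) :
  nat_row F m d *m P = row d P.
Proof. by rewrite rowE nat_row_delta. Qed.

(** The chain matrix P satisfies P B = J P row by row, J being the Jordan matrix: [B] moves each row
    to the next and kills the last row of each chain. *)
Lemma jordan_shape_chains (F : fieldType) (n a b : nat) (B : 'M[F]_n) (u w : 'rV[F]_n) :
  is_partition [:: a; b] n -> u *m B ^+ a = 0 -> w *m B ^+ b = 0 ->
  row_full (chains_mx F n B a u w) -> jordan_shape B [:: a; b].
Proof.
move=> part ua wb full; split=> //.
have [ba b_gt0 nE] : [/\ b <= a, 0 < b & n = a + b]%N.
  by case/and3P: part => /= /andP[le _] /and3P[_ ? _] /eqP e; split => //; lia.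
have uP : chains_mx F n B a u w \in unitmx by rewrite -row_full_unit.
exists (chains_mx F n B a u w); split=> //.
suff PB : chains_mx F n B a u w *m B = jordan_nil_mx F n [:: a; b] *m chains_mx F n B a u w.
  by rewrite -mulmxA -PB mulKmx.
apply/row_matrixP => i; rewrite !row_mul row_jordan_nil_mx rowK.
rewrite /block_starts /= !addn0 !inE.
have lt_in := ltn_ord i.
have -> : (if (i < a)%N then u *m B ^+ i else w *m B ^+ (i - a)) *m B
  = (if (i < a)%N then u *m B ^+ i.+1 else w *m B ^+ (i.+1 - a)).
  by case: ltnP => ia; rewrite ?subSn // exprSr -mulmxE mulmxA.
have [ia|ia] := eqVneq i.+1 a.
  by rewrite /= mul0mx ifT ?ia //; lia.
(* [block_starts] also lists the total [a + b], so the end of the second chain is treated like that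
   of the first. *)
have [ib|ib] := eqVneq i.+1 (a + b)%N.
  by rewrite /= mul0mx ifF ?ib ?addKn //; lia.
have lt_i1 : (i.+1 < n)%N by lia.
rewrite -[i.+1]/(nat_of_ord (Ordinal lt_i1)) nat_row_mul rowK /=.
by have -> : (i.+1 < a)%N = (i < a)%N by lia.
Qed.

(** Exponents past the end of a chain give the zero vector; the others give rows of the matrix. *)
Lemma chains_mx_sub (F : fieldType) (n a b : nat) (B : 'M[F]_n) (u w : 'rV[F]_n) (i : nat) :
  n = (a + b)%N -> u *m B ^+ a = 0 -> w *m B ^+ b = 0 ->
  (u *m B ^+ i <= chains_mx F n B a u w)%MS /\ (w *m B ^+ i <= chains_mx F n B a u w)%MS.
Proof.
move=> nE ua wb; split.
  have [ia|ia] := ltnP i a; last first.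
    by rewrite -(subnKC ia) exprD -mulmxE mulmxA ua mul0mx sub0mx.
  have lt_in : (i < n)%N by lia.
  by have := row_sub (Ordinal lt_in) (chains_mx F n B a u w); rewrite rowK /= ia.
have [ib|ib] := ltnP i b; last first.
  by rewrite -(subnKC ib) exprD -mulmxE mulmxA wb mul0mx sub0mx.
have lt_in : (a + i < n)%N by lia.
have := row_sub (Ordinal lt_in) (chains_mx F n B a u w).
by rewrite rowK /= ltnNge leq_addr /= addKn.
Qed.

Lemma jordan_shape_refl (F : fieldType) (n : nat) (s : seq nat) :
  is_partition s n -> jordan_shape (jordan_nil_mx F n s) s.
Proof.
by split=> //; exists 1%:M; rewrite unitmx1 invmx1 mul1mx mulmx1.
Qed.

(** On pairs of elements of F[t]/(t^(k+1)) the matrix sends (f, g) to (t f, f + t g). Chains of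
    lengths [k.+2] and [k] are exhibited and shown to span. *)
Lemma jordan_shape_coupled_shifts (F : fieldType) (k : nat) : (0 < k)%N -> [pchar F] =i pred0 ->
  jordan_shape (block_mx (shift_mx F k.+1 1) 1%:M 0 (shift_mx F k.+1 1)) [:: k.+2; k].
Proof.
move=> k_gt0 charF; set B := block_mx _ _ _ _.
pose t := nat_row F k.+1.
have tS d : t d *m shift_mx F k.+1 1 = t d.+1 by rewrite nat_row_shift addn1.
have t0 d : (k < d)%N -> t d = 0 by exact: nat_row_out.
(* [u] and [w] generate the two Jordan chains; [w] is homogeneous of degree 1
   and the coefficient [- k] makes [w B^k] vanish. *)
pose u : 'rV_(k.+1 + k.+1) := row_mx (t 0%N) 0.
pose w := row_mx (t 1%N) (- k%:R *: t 0%N).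
(* The truncated [i.-1] at [i = 0] is harmless, its coefficient being 0. *)
have uB i : u *m B ^+ i = row_mx (t i) (i%:R *: t i.-1).
  elim: i => [|i IH]; first by rewrite expr0 mulmx1 scale0r.
  rewrite exprSr -mulmxE mulmxA IH mul_row_block mulmx1 mulmx0 addr0 tS -scalemxAl tS.
  congr row_mx; case: i {IH} => [|i] /=; first by rewrite scale0r addr0 scale1r.
  by rewrite [in RHS]mulrSr scalerDl scale1r addrC.
have wB i : w *m B ^+ i = row_mx (t i.+1) ((i%:R - k%:R) *: t i).
  elim: i => [|i IH]; first by rewrite expr0 mulmx1 sub0r.
  rewrite exprSr -mulmxE mulmxA IH mul_row_block mulmx1 mulmx0 addr0 tS -scalemxAl tS.
  by congr row_mx; rewrite -[X in X + _]scale1r -scalerDl mulrS addrA.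
have ua : u *m B ^+ k.+2 = 0 by rewrite uB /= !t0 // scaler0 row_mx0.
have wb : w *m B ^+ k = 0 by rewrite wB t0 // subrr scale0r row_mx0.
apply: (jordan_shape_chains _ _ _ _ _ u w) => //.
  by rewrite /is_partition /= k_gt0 /geq /= ; lia.
set P := chains_mx _ _ _ _ _ _.
have nE : (k.+1 + k.+1 = k.+2 + k)%N by lia.
have sub i := chains_mx_sub _ _ _ _ B u w i nE ua wb.
(* u B^(d+1) - w B^d = (0, (k+1) t^d); characteristic 0 allows division by k+1. *)
have sub2 d : (row_mx 0 (t d) <= P)%MS.
  have k1 : (k.+1)%:R != 0 :> F by rewrite ((pcharf0P F).1 charF).
  have -> : row_mx 0 (t d) = (k.+1)%:R^-1 *: (u *m B ^+ d.+1 - w *m B ^+ d).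
    rewrite uB wB opp_row_mx add_row_mx subrr -scalerBl scale_row_mx scaler0 scalerA.
    have -> : d.+1%:R - (d%:R - k%:R) = k.+1%:R :> F.
      by rewrite opprB addrA -natrD addSnnS addnC natrD addrK.
    by rewrite mulVf ?scale1r.
  by rewrite scalemx_sub // addmx_sub ?eqmx_opp //; case: (sub d.+1); case: (sub d).
have sub1 d : (row_mx (t d) 0 <= P)%MS.
  have -> : row_mx (t d) 0 = u *m B ^+ d - d%:R *: row_mx 0 (t d.-1).
    by rewrite uB scale_row_mx scaler0 opp_row_mx add_row_mx subr0 subrr.
  by rewrite addmx_sub ?eqmx_opp ?scalemx_sub //; case: (sub d).
rewrite -sub1mx; apply/row_subP => i; rewrite row1.
have [i' ->|i' ->] := split_ordP i.
  by rewrite delta_mx_lshift -nat_row_delta.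
by rewrite delta_mx_rshift -nat_row_delta.
Qed.

Lemma commuting_example (F : fieldType) (k : nat) :
  (0 < k)%N -> [pchar F] =i pred0 ->
  exists A B : 'M[F]_(k.+1 + k.+1),
    A *m B = B *m A /\ jordan_shape A [:: k.+1; k.+1] /\ jordan_shape B [:: k.+2; k].
Proof.
move=> k_gt0 charF; exists (jordan_nil_mx F _ [:: k.+1; k.+1]).
exists (block_mx (shift_mx F k.+1 1) 1%:M 0 (shift_mx F k.+1 1)); split; last split.
- by rewrite jordan_nil_mx2E !mulmx_block !mul1mx !mulmx1 !mul0mx !mulmx0 !addr0 !add0r.
- by apply: jordan_shape_refl; rewrite /is_partition /= /geq /= leqnn addn0 eqxx.
exact: jordan_shape_coupled_shifts.
Qed.

Theorem theorem3p1 (F : closedFieldType) (charF0 : [pchar F] =i pred0)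
  (n l1 l2 m1 m2 : nat)
  (Hl : is_partition [:: l1; l2] n) (Hm : is_partition [:: m1; m2] n)
  (Hdist : [:: l1; l2] <> [:: m1; m2]) :
  (exists B A : 'M[F]_n,
      nilpotent_mx B /\ nilpotent_mx A /\ B *m A = A *m B /\
      jordan_shape B [:: l1; l2] /\ jordan_shape A [:: m1; m2])
  <->
  (~~ odd n /\
   (([:: l1; l2] = [:: n./2; n./2] /\ [:: m1; m2] = [:: n./2 + 1; n./2 - 1])%N \/
    ([:: m1; m2] = [:: n./2; n./2] /\ [:: l1; l2] = [:: n./2 + 1; n./2 - 1])%N)).
Proof.
have [l2_gt0 nEl] : (0 < l2)%N /\ n = (l1 + l2)%N.
  by case/and3P: Hl => _ /= /and3P[_ ? _] /eqP e; split => //; lia.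
have [m2_gt0 nEm] : (0 < m2)%N /\ n = (m1 + m2)%N.
  by case/and3P: Hm => _ /= /and3P[_ ? _] /eqP e; split => //; lia.
have nilp a b (C : 'M[F]_n) : jordan_shape C [:: a; b] -> nilpotent_mx C.
  by move=> sC; exists a; apply: jordan_shape_nilp sC _.
split=> [[B [A [_ [_ [BA [sB sA]]]]]]|[_ cases]].
  (* The largest part determines a two-part partition of [n], so equality contradicts
     distinctness. *)
  have [lt_ml|lt_lm|eq_lm] := ltngtP m1 l1.
  - have [mE lE] := comm_two_blocks_shapes _ _ _ _ _ _ _ _ (esym BA) sA sB lt_ml.
    by split; [lia | right; split; congr [:: _; _]; lia].
  - have [lE mE] := comm_two_blocks_shapes _ _ _ _ _ _ _ _ BA sB sA lt_lm.
    by split; [lia | left; split; congr [:: _; _]; lia].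
  by case: Hdist; congr [:: _; _]; lia.
(* One commuting pair serves both cases, after exchanging its members. *)
suff [A [B [AB [sA sB]]]] : exists A B : 'M[F]_n, A *m B = B *m A /\
    jordan_shape A [:: n./2; n./2] /\ jordan_shape B [:: (n./2 + 1)%N; (n./2 - 1)%N].
  have [nA nB] := (nilp _ _ _ sA, nilp _ _ _ sB).
  by case: cases => -[-> ->]; [exists A, B | exists B, A].
(* Here [k] is the part n/2 - 1, positive as a part of one of the given partitions. *)
have [k k_gt0 nE] : exists2 k, (0 < k)%N & n = (k.+1 + k.+1)%N.
  by exists n./2.-1; case: cases => -[[? ?] [? ?]]; lia.
move: nE; clear -k_gt0 charF0 => ->.
have -> : (k.+1 + k.+1)./2 = k.+1 by lia.
rewrite addn1 subn1; exact: commuting_example.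
Qed.
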